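(* Let $(\mathfrak a,\alpha,\beta)$ be a multiplicative Hom-Lie antialgebra and let $\rho=(\rho_0,\rho_1)$ be a representation of $(\mathfrak a,\alpha,\beta)$ over $(V,\alpha_{V_0},\beta_{V_1})$. Then there is a one-to-one correspondence between the set of equivalence classes of abelian extensions of the Hom-Lie antialgebra $(\mathfrak a,\alpha,\beta)$ by $(V,\alpha_{V_0},\beta_{V_1})$ (those inducing the given representation $\rho$) and the elements of the second cohomology group $H^2(\mathfrak a,V)$.
   Context: The base field is algebraically closed of characteristic $0$. **Hom-Lie antialgebras.** A Hom-Lie antialgebra $(\mathfrak a,\alpha,\beta)$ is a $\mathbb Z_2$-graded algebra $\mathfrak a=\mathfrak a_0\oplus\mathfrak a_1$, $\mathfrak a_i\cdot\mathfrak a_j\subset\mathfrak a_{i+j}$, which is supercommutative ($x\cdot x'=x'\cdot x$, $x\cdot y=y\cdot x$ for $x,x'\in\mathfrak a_0$, $y\in\mathfrak a_1$, and the product of odd elements, written $[y,y']$, satisfies $[y,y']=-[y',y]$), with linear maps $\alpha:\mathfrak a_0\to\mathfrak a_0$, $\beta:\mathfrak a_1\to\mathfrak a_1$ such that for all $x_i\in\mathfrak a_0$, $y_i\in\mathfrak a_1$: (1) $\alpha(x_1)\cdot(x_2\cdot x_3)=(x_1\cdot x_2)\cdot\alpha(x_3)$; (2) $\alpha(x_1)\cdot(x_2\cdot y_1)=\frac12(x_1\cdot x_2)\cdot\beta(y_1)$; (3) $\alpha(x_1)\cdot[y_1,y_2]=[x_1\cdot y_1,\beta(y_2)]+[\beta(y_1),x_1\cdot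 y_2]$; (4) $\beta(y_1)\cdot[y_2,y_3]+\beta(y_2)\cdot[y_3,y_1]+\beta(y_3)\cdot[y_1,y_2]=0$. It is multiplicative if $\alpha(x_1\cdot x_2)=\alpha(x_1)\cdot\alpha(x_2)$, $\beta(x_1\cdot y_1)=\alpha(x_1)\cdot\beta(y_1)$, $\alpha([y_1,y_2])=[\beta(y_1),\beta(y_2)]$. All Hom-Lie antialgebras (including the extensions below) are assumed multiplicative. It is abelian if all products and brackets vanish. A homomorphism $\phi=(\phi_0,\phi_1):(\mathfrak a,\alpha,\beta)\to(\widetilde{\mathfrak a},\widetilde\alpha,\widetilde\beta)$ is a pair of linear maps $\phi_i:\mathfrak a_i\to\widetilde{\mathfrak a}_i$ preserving all products and brackets, with $\phi_0\circ\alpha=\widetilde\alpha\circ\phi_0$ and $\phi_1\circ\beta=\widetilde\beta\circ\phi_1$. **Representations.** Let $V=V_0\oplus V_1$ be a $\mathbb Z_2$-graded vector space with linear maps $\alpha_{V_0}:V_0\to V_0$, $\beta_{V_1}:V_1\to V_1$. Put $\mathrm{End}(V)_0=\mathrm{Hom}(V_0,V_0)\oplus\mathrm{Hom}(V_1,V_1)$ and $\mathrm{End}(V)_1=\mathrm{Hom}(V_0,V_1)\oplus\mathrm{Hom}(V_1,V_0)$. A representation of $(\mathfrak a,\alpha,\beta)$ over $(V,\alpha_{V_0},\beta_{V_1})$ is a pair of linear maps $\rho_0:\mathfrak a_0\to\mathrm{End}(V)_0$, $\rho_1:\mathfrak a_1\to\mathrm{End}(V)_1$ such that for all $x,x_i\in\mathfrak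 a_0$, $y,y_i\in\mathfrak a_1$, $u\in V_0$, $w\in V_1$: $\rho_0(\alpha(x_1))\rho_0(x_2)u=\rho_0(x_1\cdot x_2)\alpha_{V_0}(u)$; $\rho_0(\alpha(x_1))\rho_0(x_2)w=\frac12\rho_0(x_1\cdot x_2)\beta_{V_1}(w)$; $\rho_0(\alpha(x))\rho_1(y)u=\frac12\rho_1(\beta(y))\rho_0(x)u$; $\rho_1(x\cdot y)\alpha_{V_0}(u)=\frac12\rho_1(\beta(y))\rho_0(x)u$; $\rho_0(\alpha(x))\rho_1(y)w=\rho_1(x\cdot y)\beta_{V_1}(w)+\rho_1(\beta(y))\rho_0(x)w$; $\rho_0([y_1,y_2])\alpha_{V_0}(u)=\rho_1(\beta(y_1))\rho_1(y_2)u-\rho_1(\beta(y_2))\rho_1(y_1)u$; $\rho_0([y_1,y_2])\beta_{V_1}(w)=\rho_1(\beta(y_2))\rho_1(y_1)w-\rho_1(\beta(y_1))\rho_1(y_2)w$. **Abelian extensions.** Regard $(V,\alpha_{V_0},\beta_{V_1})$ as an abelian Hom-Lie antialgebra. An extension of $\mathfrak a$ by $V$ is a short exact sequence $0\to V\xrightarrow{i}\widetilde{\mathfrak a}\xrightarrow{p}\mathfrak a\to0$ of Hom-Lie antialgebras and homomorphisms; it is abelian if (identifying $V$ with $i(V)$) $V$ is an abelian ideal of $\widetilde{\mathfrak a}$, i.e. $V_0\cdot V_0=V_0\cdot V_1=[V_1,V_1]=0$ and $\widetilde{\mathfrak a}\cdot V\subseteq V$. Two extensions $(\widetilde{\mathfrak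 a},i,p)$ and $(\widehat{\mathfrak a},j,q)$ are equivalent if there is a Hom-Lie antialgebra homomorphism $\phi:\widetilde{\mathfrak a}\to\widehat{\mathfrak a}$ with $\phi\circ i=j$, $q\circ\phi=p$. The representation induced by an abelian extension is defined from linear maps $\sigma_i:\mathfrak a_i\to\widetilde{\mathfrak a}_i$ with $p_i\circ\sigma_i=\mathrm{id}$ by $\rho_0(x)(u+w)=\sigma_0(x)\cdot u+\sigma_0(x)\cdot w$ and $\rho_1(y)(u+w)=\sigma_1(y)\cdot u+[\sigma_1(y),w]$; it does not depend on the choice of $\sigma$. **Second cohomology.** A 2-cocycle of $\mathfrak a$ with coefficients in $V$ is a triple $\omega=(\omega_0,\omega_1,\omega_2)$ of bilinear maps $\omega_0:\mathfrak a_0\times\mathfrak a_0\to V_0$ (symmetric), $\omega_1:\mathfrak a_0\times\mathfrak a_1\to V_1$, $\omega_2:\mathfrak a_1\times\mathfrak a_1\to V_0$ (skew-symmetric), satisfying $\alpha_{V_0}\omega_0(x_1,x_2)=\omega_0(\alpha(x_1),\alpha(x_2))$, $\beta_{V_1}\omega_1(x_1,y_1)=\omega_1(\alpha(x_1),\beta(y_1))$, $\alpha_{V_0}\omega_2(y_1,y_2)=\omega_2(\beta(y_1),\beta(y_2))$, and $\rho_0(\alpha(x_1))\omega_0(x_2,x_3)+\omega_0(\alpha(x_1),x_2\cdot x_3)=\rho_0(\alpha(x_3))\omega_0(x_1,x_2)+\omega_0(x_1\cdot x_2,\alpha(x_3))$; $\rho_0(\alpha(x_1))\omega_1(x_2,y_1)+\omega_1(\alpha(x_1),x_2\cdot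 y_1)=\frac12\rho_1(\beta(y_1))\omega_0(x_1,x_2)+\frac12\omega_1(x_1\cdot x_2,\beta(y_1))$; $\rho_0(\alpha(x_1))\omega_2(y_1,y_2)+\omega_0(\alpha(x_1),[y_1,y_2])=-\rho_1(\beta(y_2))\omega_1(x_1,y_1)+\omega_2(x_1\cdot y_1,\beta(y_2))+\rho_1(\beta(y_1))\omega_1(x_1,y_2)+\omega_2(\beta(y_1),x_1\cdot y_2)$; $\sum_{\mathrm{cyc}(1,2,3)}\big(\rho_1(\beta(y_1))\omega_2(y_2,y_3)+\omega_1([y_2,y_3],\beta(y_1))\big)=0$. Two 2-cocycles $\omega,\omega'$ are in the same cohomology class if there are linear maps $f_0:\mathfrak a_0\to V_0$, $f_1:\mathfrak a_1\to V_1$ with $\alpha_{V_0}f_0=f_0\alpha$, $\beta_{V_1}f_1=f_1\beta$ and $(\omega_0-\omega_0')(x_1,x_2)=\rho_0(x_1)f_0(x_2)+\rho_0(x_2)f_0(x_1)-f_0(x_1\cdot x_2)$, $(\omega_1-\omega_1')(x_1,y_1)=\rho_0(x_1)f_1(y_1)+\rho_1(y_1)f_0(x_1)-f_1(x_1\cdot y_1)$, $(\omega_2-\omega_2')(y_1,y_2)=\rho_1(y_1)f_1(y_2)-\rho_1(y_2)f_1(y_1)-f_0([y_1,y_2])$. $H^2(\mathfrak a,V)$ is the set of cohomology classes of 2-cocycles.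
   Formalization: Adds that ρ is compatible with the twisting maps (the semidirect product is multiplicative), and counts only abelian extensions having a linear section σ that commutes with the twisting maps; the claim as written fails without either condition. *)

(* Defs.v *)
From HB Require Import structures.
From mathcomp Require Import all_boot all_order all_algebra.

Set Implicit Arguments.
Unset Strict Implicit.
Unset Printing Implicit Defensive.

Import GRing.Theory.
Local Open Scope ring_scope.

Section Quotient.
Variables (T : Type) (A : T -> Prop) (R : T -> T -> Prop).

(* The class of x and the set A / R of classes, for R an equivalence relation
   on the subset A of T.  (The type of sets of the classical library cannot be
   used: its universe lies below that of the type of extensions.) *)
Definition class_of (x : T) : T -> Prop := fun y => A y /\ R x y.
Definition quotient_set : Type :=
  {c : T -> Prop | exists x, A x /\ c = class_of x}.
End Quotient.

(* The zero product, used to regard a graded space as an abelian algebra. *)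
Section ZeroBilinear.
Variables (R : nzRingType) (U V W : lmodType R).

Definition zero_bilinear (u : U) (v : V) : W := 0.

Fact zero_bilinear_is_bilinear : bilinear_for *:%R *:%R zero_bilinear.
Proof.
by split=> ? ? ? ?; rewrite /= /zero_bilinear GRing.scaler0 GRing.addr0.
Qed.

HB.instance Definition _ :=
  bilinear_isBilinear.Build R U V W *:%R *:%R zero_bilinear
    zero_bilinear_is_bilinear.
End ZeroBilinear.

Section HomLieAntialgebras.
Variable K : closedFieldType.

Local Notation "2^-1" := ((2%:R : K)^-1).

(* A Z_2-graded vector space, of arbitrary dimension, with its even and odd
   twisting maps. *)
Record hom_space := HomSpace {
  sp0 : lmodType K;
  sp1 : lmodType K;
  tw0 : {linear sp0 -> sp0};
  tw1 : {linear sp1 -> sp1}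
}.

(* The product a_1 x a_0 -> a_1 is determined by supercommutativity,
   y . x = x . y, so only a_0 x a_1 -> a_1 is recorded; each y . x in an axiom
   is written mul01 x y. *)
Record hom_Lie_antialgebra := HomLieAntialgebra {
  hla_space :> hom_space;
  mul00 : {bilinear sp0 hla_space -> sp0 hla_space -> sp0 hla_space};
  mul01 : {bilinear sp0 hla_space -> sp1 hla_space -> sp1 hla_space};
  bra11 : {bilinear sp1 hla_space -> sp1 hla_space -> sp0 hla_space};
  mul00C : forall x1 x2, mul00 x1 x2 = mul00 x2 x1;
  bra11N : forall y1 y2, bra11 y1 y2 = - bra11 y2 y1;
  hla_ax1 : forall x1 x2 x3,
    mul00 (tw0 _ x1) (mul00 x2 x3) = mul00 (mul00 x1 x2) (tw0 _ x3);
  hla_ax2 : forall x1 x2 y1,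
    mul01 (tw0 _ x1) (mul01 x2 y1) = 2^-1 *: mul01 (mul00 x1 x2) (tw1 _ y1);
  hla_ax3 : forall x1 y1 y2,
    mul00 (tw0 _ x1) (bra11 y1 y2) =
      bra11 (mul01 x1 y1) (tw1 _ y2) + bra11 (tw1 _ y1) (mul01 x1 y2);
  hla_ax4 : forall y1 y2 y3,
    mul01 (bra11 y2 y3) (tw1 _ y1) + mul01 (bra11 y3 y1) (tw1 _ y2)
      + mul01 (bra11 y1 y2) (tw1 _ y3) = 0
}.

Definition multiplicative (A : hom_Lie_antialgebra) : Prop :=
  [/\ forall x1 x2 : sp0 A,
        tw0 A (mul00 A x1 x2) = mul00 A (tw0 A x1) (tw0 A x2),
      forall (x1 : sp0 A) (y1 : sp1 A),
        tw1 A (mul01 A x1 y1) = mul01 A (tw0 A x1) (tw1 A y1)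
    & forall y1 y2 : sp1 A,
        tw0 A (bra11 A y1 y2) = bra11 A (tw1 A y1) (tw1 A y2)].

Record hla_hom (A B : hom_Lie_antialgebra) := HlaHom {
  hom0 : {linear sp0 A -> sp0 B};
  hom1 : {linear sp1 A -> sp1 B};
  hom_mul00 : forall x1 x2, hom0 (mul00 A x1 x2) = mul00 B (hom0 x1) (hom0 x2);
  hom_mul01 : forall x y, hom1 (mul01 A x y) = mul01 B (hom0 x) (hom1 y);
  hom_bra11 : forall y1 y2, hom0 (bra11 A y1 y2) = bra11 B (hom1 y1) (hom1 y2);
  hom_tw0 : forall x, hom0 (tw0 A x) = tw0 B (hom0 x);
  hom_tw1 : forall y, hom1 (tw1 A y) = tw1 B (hom1 y)
}.

Definition abelian_hla (V : hom_space) : hom_Lie_antialgebra.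
Proof.
refine (@HomLieAntialgebra V
    (@zero_bilinear K (sp0 V) (sp0 V) (sp0 V))
    (@zero_bilinear K (sp0 V) (sp1 V) (sp1 V))
    (@zero_bilinear K (sp1 V) (sp1 V) (sp0 V)) _ _ _ _ _ _);
  rewrite /= /zero_bilinear => *; by rewrite ?oppr0 ?scaler0 ?addr0.
Defined.

(* rho_0 : a_0 -> Hom(V_0,V_0) + Hom(V_1,V_1) and
   rho_1 : a_1 -> Hom(V_0,V_1) + Hom(V_1,V_0), in components and uncurried:
   r00, r01 are rho_0 acting on V_0, V_1, and r10, r11 are rho_1 acting on
   V_0, V_1. *)
Record representation (A : hom_Lie_antialgebra) (V : hom_space) :=
  Representation {
  r00 : {bilinear sp0 A -> sp0 V -> sp0 V};
  r01 : {bilinear sp0 A -> sp1 V -> sp1 V};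
  r10 : {bilinear sp1 A -> sp0 V -> sp1 V};
  r11 : {bilinear sp1 A -> sp1 V -> sp0 V};
  rep_ax1 : forall x1 x2 u,
    r00 (tw0 A x1) (r00 x2 u) = r00 (mul00 A x1 x2) (tw0 V u);
  rep_ax2 : forall x1 x2 w,
    r01 (tw0 A x1) (r01 x2 w) = 2^-1 *: r01 (mul00 A x1 x2) (tw1 V w);
  rep_ax3 : forall x y u,
    r01 (tw0 A x) (r10 y u) = 2^-1 *: r10 (tw1 A y) (r00 x u);
  rep_ax4 : forall x y u,
    r10 (mul01 A x y) (tw0 V u) = 2^-1 *: r10 (tw1 A y) (r00 x u);
  rep_ax5 : forall x y w,
    r00 (tw0 A x) (r11 y w) =
      r11 (mul01 A x y) (tw1 V w) + r11 (tw1 A y) (r01 x w);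
  rep_ax6 : forall y1 y2 u,
    r00 (bra11 A y1 y2) (tw0 V u) =
      r11 (tw1 A y1) (r10 y2 u) - r11 (tw1 A y2) (r10 y1 u);
  rep_ax7 : forall y1 y2 w,
    r01 (bra11 A y1 y2) (tw1 V w) =
      r10 (tw1 A y2) (r11 y1 w) - r10 (tw1 A y1) (r11 y2 w)
}.

(* The multiplicativity of the semidirect product of A and V along rho.  It
   does not follow from the axioms of a representation, and it holds whenever
   rho is induced by a multiplicative abelian extension. *)
Definition multiplicative_rep (A : hom_Lie_antialgebra) (V : hom_space)
    (rho : representation A V) : Prop :=
  [/\ forall x u, tw0 V (r00 rho x u) = r00 rho (tw0 A x) (tw0 V u),
      forall x w, tw1 V (r01 rho x w) = r01 rho (tw0 A x) (tw1 V w),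
      forall y u, tw1 V (r10 rho y u) = r10 rho (tw1 A y) (tw0 V u)
    & forall y w, tw0 V (r11 rho y w) = r11 rho (tw1 A y) (tw1 V w)].

Record extension (A : hom_Lie_antialgebra) (V : hom_space) := Extension {
  ext_alg :> hom_Lie_antialgebra;
  ext_i : hla_hom (abelian_hla V) ext_alg;
  ext_p : hla_hom ext_alg A;
  ext_i0_inj : injective (hom0 ext_i);
  ext_i1_inj : injective (hom1 ext_i);
  ext_exact0 : forall e, hom0 ext_p e = 0 <-> exists u, hom0 ext_i u = e;
  ext_exact1 : forall e, hom1 ext_p e = 0 <-> exists w, hom1 ext_i w = e;
  ext_p0_surj : forall x, exists e, hom0 ext_p e = x;
  ext_p1_surj : forall y, exists e, hom1 ext_p e = y
}.

Section Extensions.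
Variables (A : hom_Lie_antialgebra) (V : hom_space).

Definition extension_equiv (E F : extension A V) : Prop :=
  exists phi : hla_hom E F,
    [/\ forall u, hom0 phi (hom0 (ext_i E) u) = hom0 (ext_i F) u,
        forall w, hom1 phi (hom1 (ext_i E) w) = hom1 (ext_i F) w,
        forall e, hom0 (ext_p F) (hom0 phi e) = hom0 (ext_p E) e
      & forall e, hom1 (ext_p F) (hom1 phi e) = hom1 (ext_p E) e].

Definition abelian_ideal (B : hom_Lie_antialgebra)
    (I0 : sp0 B -> Prop) (I1 : sp1 B -> Prop) : Prop :=
  [/\ forall u u', I0 u -> I0 u' -> mul00 B u u' = 0,
      forall u w, I0 u -> I1 w -> mul01 B u w = 0
    & forall w w', I1 w -> I1 w' -> bra11 B w w' = 0] /\
  [/\ forall x u, I0 u -> I0 (mul00 B x u),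
      forall x w, I1 w -> I1 (mul01 B x w),
      forall y u, I0 u -> I1 (mul01 B u y)
    & forall y w, I1 w -> I0 (bra11 B y w)].

Definition abelian_extension (E : extension A V) : Prop :=
  abelian_ideal (fun e => exists u, hom0 (ext_i E) u = e)
                (fun e => exists w, hom1 (ext_i E) w = e).

Definition linear_section (E : extension A V)
    (s0 : {linear sp0 A -> sp0 E}) (s1 : {linear sp1 A -> sp1 E}) : Prop :=
  (forall x, hom0 (ext_p E) (s0 x) = x) /\
  (forall y, hom1 (ext_p E) (s1 y) = y).

Definition hom_section (E : extension A V)
    (s0 : {linear sp0 A -> sp0 E}) (s1 : {linear sp1 A -> sp1 E}) : Prop :=
  [/\ linear_section s0 s1,
      forall x, s0 (tw0 A x) = tw0 E (s0 x)
    & forall y, s1 (tw1 A y) = tw1 E (s1 y)].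

(* The components of rho_0(x)(u + w) = s0(x).u + s0(x).w and of
   rho_1(y)(u + w) = s1(y).u + [s1(y), w]; note that s1(y).u = u.s1(y). *)
Definition induces (E : extension A V) (rho : representation A V) : Prop :=
  exists (s0 : {linear sp0 A -> sp0 E}) (s1 : {linear sp1 A -> sp1 E}),
    let i0 := hom0 (ext_i E) in let i1 := hom1 (ext_i E) in
    linear_section s0 s1 /\
    [/\ forall x u, i0 (r00 rho x u) = mul00 E (s0 x) (i0 u),
        forall x w, i1 (r01 rho x w) = mul01 E (s0 x) (i1 w),
        forall y u, i1 (r10 rho y u) = mul01 E (i0 u) (s1 y)
      & forall y w, i0 (r11 rho y w) = bra11 E (s1 y) (i1 w)].

(* The sections sigma are required to exist as morphisms of spaces with
   twisting maps (hom_section).  This is not automatic: when all products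
   vanish, the twisting map of E may be a non-semisimple extension of that of A
   by that of V, and such an E is invisible to the 2-cocycles below, which only
   deform the products. *)
Definition abelian_extensions (rho : representation A V)
    (E : extension A V) : Prop :=
  [/\ multiplicative E, abelian_extension E, induces E rho
    & exists (s0 : {linear sp0 A -> sp0 E})
             (s1 : {linear sp1 A -> sp1 E}), hom_section s0 s1].

Definition extension_classes (rho : representation A V) : Type :=
  quotient_set (abelian_extensions rho) extension_equiv.

End Extensions.

Section Cohomology.
Variables (A : hom_Lie_antialgebra) (V : hom_space).

Record cochain2 := Cochain2 {
  w0 : {bilinear sp0 A -> sp0 A -> sp0 V};
  w1 : {bilinear sp0 A -> sp1 A -> sp1 V};
  w2 : {bilinear sp1 A -> sp1 A -> sp0 V}
}.

Variable rho : representation A V.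

Definition cocycle2 (w : cochain2) : Prop :=
  [/\ forall x1 x2, w0 w x1 x2 = w0 w x2 x1
    & forall y1 y2, w2 w y1 y2 = - w2 w y2 y1] /\
  [/\ forall x1 x2, tw0 V (w0 w x1 x2) = w0 w (tw0 A x1) (tw0 A x2),
      forall x1 y1, tw1 V (w1 w x1 y1) = w1 w (tw0 A x1) (tw1 A y1)
    & forall y1 y2, tw0 V (w2 w y1 y2) = w2 w (tw1 A y1) (tw1 A y2)] /\
  [/\ forall x1 x2 x3,
        r00 rho (tw0 A x1) (w0 w x2 x3) + w0 w (tw0 A x1) (mul00 A x2 x3) =
        r00 rho (tw0 A x3) (w0 w x1 x2) + w0 w (mul00 A x1 x2) (tw0 A x3),
      forall x1 x2 y1,
        r01 rho (tw0 A x1) (w1 w x2 y1) + w1 w (tw0 A x1) (mul01 A x2 y1) =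
        2^-1 *: r10 rho (tw1 A y1) (w0 w x1 x2)
          + 2^-1 *: w1 w (mul00 A x1 x2) (tw1 A y1),
      forall x1 y1 y2,
        r00 rho (tw0 A x1) (w2 w y1 y2) + w0 w (tw0 A x1) (bra11 A y1 y2) =
        - r11 rho (tw1 A y2) (w1 w x1 y1) + w2 w (mul01 A x1 y1) (tw1 A y2)
          + r11 rho (tw1 A y1) (w1 w x1 y2) + w2 w (tw1 A y1) (mul01 A x1 y2)
    & forall y1 y2 y3,
        (r10 rho (tw1 A y1) (w2 w y2 y3) + w1 w (bra11 A y2 y3) (tw1 A y1))
        + (r10 rho (tw1 A y2) (w2 w y3 y1) + w1 w (bra11 A y3 y1) (tw1 A y2))
        + (r10 rho (tw1 A y3) (w2 w y1 y2) + w1 w (bra11 A y1 y2) (tw1 A y3))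
        = 0].

Definition cohomologous (w w' : cochain2) : Prop :=
  exists (f0 : {linear sp0 A -> sp0 V}) (f1 : {linear sp1 A -> sp1 V}),
    [/\ forall x, tw0 V (f0 x) = f0 (tw0 A x)
      & forall y, tw1 V (f1 y) = f1 (tw1 A y)] /\
    [/\ forall x1 x2, w0 w x1 x2 - w0 w' x1 x2 =
          r00 rho x1 (f0 x2) + r00 rho x2 (f0 x1) - f0 (mul00 A x1 x2),
        forall x1 y1, w1 w x1 y1 - w1 w' x1 y1 =
          r01 rho x1 (f1 y1) + r10 rho y1 (f0 x1) - f1 (mul01 A x1 y1)
      & forall y1 y2, w2 w y1 y2 - w2 w' y1 y2 =
          r11 rho y1 (f1 y2) - r11 rho y2 (f1 y1) - f0 (bra11 A y1 y2)].

Definition H2 : Type := quotient_set cocycle2 cohomologous.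

End Cohomology.

(* w measures the failure of the section (s0, s1) to preserve products. *)
Definition cochain_of_section (A : hom_Lie_antialgebra) (V : hom_space)
    (E : extension A V)
    (s0 : {linear sp0 A -> sp0 E}) (s1 : {linear sp1 A -> sp1 E})
    (w : cochain2 A V) : Prop :=
  [/\ forall x1 x2, hom0 (ext_i E) (w0 w x1 x2) =
        mul00 E (s0 x1) (s0 x2) - s0 (mul00 A x1 x2),
      forall x y, hom1 (ext_i E) (w1 w x y) =
        mul01 E (s0 x) (s1 y) - s1 (mul01 A x y)
    & forall y1 y2, hom0 (ext_i E) (w2 w y1 y2) =
        bra11 E (s1 y1) (s1 y2) - s0 (bra11 A y1 y2)].

End HomLieAntialgebras.

(* Main.v *)
Require Import Defs.
From HB Require Import structures.
From mathcomp Require Import all_boot all_order all_algebra.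
From mathcomp Require Import boolp.

Set Implicit Arguments.
Unset Strict Implicit.
Unset Printing Implicit Defensive.

Import GRing.Theory Defs.
Local Open Scope ring_scope.

(** Abelian extensions are classified by the failure of their sections to
    preserve products.

    Let E be an abelian extension inducing rho, with a linear section s that
    commutes with the twisting maps.  Every element of E is s(x) + i(u) for
    unique x and u, and since V is an abelian ideal on which s(x) acts by rho,
<<
    (s(x) + i(u)) (s(x') + i(u')) = s(x x') + i(rho(x)u' + rho(x')u + w(x, x'))
>>
    where i(w(x, x')) = s(x) s(x') - s(x x'), and similarly for the two other
    products, with a sign for the bracket ([split_mul00], [split_mul01],
    [split_bra11]).  All of E can thus be read off from A, V, rho and the
    cochain w:
    - the V-component of each identity of E, evaluated on elements s(x), is the
      corresponding cocycle identity of w ([cocycle_of_section]);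
    - conversely, for a cocycle w the same formulas define an extension on the
      direct sum of A and V, whose section x |-> (x, 0) has cochain w
      ([cocycle_ext]);
    - an equivalence from (E, s, w) to (F, t, w') is determined by its values
      t(x) + j(f(x)) on the elements s(x), and preserving products amounts to
      w - w' being the coboundary of f ([equiv_cohomologous],
      [cohomologous_equiv]).

    Hence the relation `w is the cochain of some section of E' is total and
    onto, and it turns equivalence into cohomology.  Any relation of this kind
    induces a bijection of quotient sets ([quotient_correspondence]), and this
    holds regardless of which section is chosen. *)

(** * Bijections between quotient sets *)

Section QuotientBijection.
Variables (T U : Type) (A : T -> Prop) (B : U -> Prop).
Variables (R : T -> T -> Prop) (S : U -> U -> Prop) (C : T -> U -> Prop).

(** A relation C under which R and S correspond to each other sends the class
    of a onto the class of any b with C a b.  Taking whole images and preimages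
    under C avoids choosing a representative in each class. *)
Lemma quotient_correspondence :
    (forall a, A a -> exists b, C a b) ->
    (forall a b, A a -> C a b -> B b) ->
    (forall b, B b -> exists2 a, A a & C a b) ->
    (forall a a' b b', A a -> A a' -> C a b -> C a' b' ->
       R a a' <-> S b b') ->
  exists Phi : quotient_set A R -> quotient_set B S,
    bijective Phi /\ forall c a b, sval c a -> C a b -> sval (Phi c) b.
Proof.
move=> Ctot CB Csurj CRS.
pose f (c : T -> Prop) b := exists2 a, c a & C a b.
pose g (d : U -> Prop) a := A a /\ exists2 b, C a b & d b.
have fE a b : A a -> C a b -> f (class_of A R a) = class_of B S b.
  move=> Aa Cab; apply: funext => b'; apply: propext; split.
    move=> [a' [Aa' Raa'] Ca'b'].
    by split; [exact: CB Ca'b' | exact/(CRS a a')].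
  move=> [Bb' Sbb']; have [a' Aa' Ca'b'] := Csurj _ Bb'.
  by exists a' => //; split=> //; exact/(CRS a a' b b').
have gE a b : A a -> C a b -> g (class_of B S b) = class_of A R a.
  move=> Aa Cab; apply: funext => a'; apply: propext; split.
    by move=> [Aa' [b' Ca'b' [_ Sbb']]]; split=> //; exact/(CRS a a' b b').
  move=> [Aa' Raa']; split=> //; have [b' Ca'b'] := Ctot _ Aa'.
  by exists b' => //; split; [exact: CB Ca'b' | exact/(CRS a a')].
have fP (c : quotient_set A R) : exists b, B b /\ f (sval c) = class_of B S b.
  case: c => c [a [Aa cE]]; rewrite /= cE; have [b Cab] := Ctot _ Aa.
  by exists b; split; [exact: CB Cab | exact: fE].
have gP (d : quotient_set B S) : exists a, A a /\ g (sval d) = class_of A R a.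
  case: d => d [b [Bb dE]]; rewrite /= dE; have [a Aa Cab] := Csurj _ Bb.
  by exists a; split=> //; exact: gE.
exists (fun c => exist _ (f (sval c)) (fP c)); split; last first.
  by move=> c a b ca Cab; exists a.
exists (fun d => exist _ (g (sval d)) (gP d)).
  move=> [c cP]; apply: eq_exist => /=.
  case: cP => a [Aa ->]; have [b Cab] := Ctot _ Aa.
  by rewrite (fE _ b) // (gE a).
move=> [d dP]; apply: eq_exist => /=.
case: dP => b [Bb ->]; have [a Aa Cab] := Csurj _ Bb.
by rewrite (gE a) // (fE _ b).
Qed.

End QuotientBijection.

(** * Linear and bilinear maps *)

(* Proves an identity between sums that agree up to the order of the
   summands, by matching the last summand on the left. *)
Ltac sum_perm :=
  rewrite ?addrA;
  lazymatch goal with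
  | |- ?x = ?x => reflexivity
  | |- _ + ?a = _ =>
      rewrite 1?[in RHS](addrC a) ?[in RHS](addrAC _ a);
      congr (_ + a); sum_perm
  end.

(* For each summand - a on the left: moves - a to the end, then a past it, so
   that they cancel. *)
Ltac sum_cancel :=
  rewrite ?addrA;
  repeat lazymatch goal with
  | |- ?L = _ =>
      match L with context [ - ?a ] =>
        rewrite 1?[in LHS](addrC (- a)) ?[in LHS](addrAC _ (- a))
          1?[in LHS](addrC a) ?[in LHS](addrAC _ a) subrK
      end
  end.

Section Linear.
Variable K : fieldType.

(** The lift is linear because i is linear and determines it uniquely. *)
Lemma linear_lift (U V W : lmodType K) (i : {linear U -> V})
    (g : {linear W -> V}) :
    injective i -> (forall w, exists u, i u = g w) ->
  exists r : {linear W -> U}, forall w, i (r w) = g w.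
Proof.
move=> i_inj /choice[r rE].
have rlin : linear r by move=> a u v; apply: i_inj; rewrite linearP !rE linearP.
pose rM := GRing.isLinear.Build K W U *:%R r rlin.
pose rL : {linear W -> U} := HB.pack r rM.
by exists rL.
Qed.

Lemma bilinear_comp (U V W U' V' W' : lmodType K) (b : {bilinear U -> V -> W})
    (g : {linear U' -> U}) (h : {linear V' -> V}) (r : {linear W -> W'}) :
  exists c : {bilinear U' -> V' -> W'}, forall u v, c u v = r (b (g u) (h v)).
Proof.
pose c u v := r (b (g u) (h v)).
have cbil : bilinear_for *:%R *:%R c.
  by split=> [v a u u'|u a v v'];
     rewrite /c linearP (linearPl, linearPr) linearP.
pose cM := bilinear_isBilinear.Build K U' V' W' *:%R *:%R c cbil.
pose cL : {bilinear U' -> V' -> W'} := HB.pack c cM.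
by exists cL.
Qed.

Section PairLinear.
Variables (U V U' V' : lmodType K).
Variables (f : {linear U -> U'}) (g : {linear V -> V'}).

Definition pair_map (e : U * V) : U' * V' := (f e.1, g e.2).

Fact pair_map_is_linear : linear pair_map.
Proof. by move=> a [u v] [u' v']; rewrite /pair_map /= !linearP. Qed.

HB.instance Definition _ :=
  GRing.isLinear.Build K (U * V)%type (U' * V')%type *:%R pair_map
    pair_map_is_linear.
End PairLinear.

Section Injections.
Variables (U V : lmodType K).

Definition inj_fst (u : U) : U * V := (u, 0).
Definition inj_snd (v : V) : U * V := (0, v).

Fact inj_fst_is_linear : linear inj_fst.
Proof. by move=> a u u'; congr (_, _); rewrite /= scaler0 addr0. Qed.
Fact inj_snd_is_linear : linear inj_snd.
Proof. by move=> a v v'; congr (_, _); rewrite /= scaler0 addr0. Qed.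

HB.instance Definition _ :=
  GRing.isLinear.Build K U (U * V)%type *:%R inj_fst inj_fst_is_linear.
HB.instance Definition _ :=
  GRing.isLinear.Build K V (U * V)%type *:%R inj_snd inj_snd_is_linear.
End Injections.

(** The product on direct sums whose component outside U3 consists of the two
    actions a and b and of the cochain c.  The scalar k is 1 for a commutative
    product and -1 for a bracket, where the action on the left factor is the
    opposite of the action on the right factor. *)
Section ExtensionProduct.
Variables (U1 U2 U3 V1 V2 V3 : lmodType K) (k : K).
Variables (m : {bilinear U1 -> U2 -> U3}) (c : {bilinear U1 -> U2 -> V3}).
Variables (a : {bilinear U1 -> V2 -> V3}) (b : {bilinear U2 -> V1 -> V3}).

Definition ext_prod (e : U1 * V1) (e' : U2 * V2) : U3 * V3 :=
  (m e.1 e'.1, a e.1 e'.2 + k *: b e'.1 e.2 + c e.1 e'.1).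

Fact ext_prod_is_bilinear : bilinear_for *:%R *:%R ext_prod.
Proof.
split=> [[u2 v2] l [u1 v1] [u1' v1']|[u1 v1] l [u2 v2] [u2' v2']];
  congr (_, _); rewrite /= ?linearPl ?linearPr //=;
  rewrite !scalerDr !scalerA (mulrC k l); sum_perm.
Qed.

HB.instance Definition _ :=
  bilinear_isBilinear.Build K (U1 * V1)%type (U2 * V2)%type (U3 * V3)%type
    *:%R *:%R ext_prod ext_prod_is_bilinear.
End ExtensionProduct.

End Linear.

Section AbelianExtensions.
Variable K : closedFieldType.
Variables (A : hom_Lie_antialgebra K) (V : hom_space K).
Variable rho : representation A V.

(** * The products of an abelian extension in terms of a section *)

(** The maps of the extension, typed with the components of V and A themselves
    rather than with those of the algebras that carry them. *)
Section Inclusion.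
Variable E : extension A V.

Definition inc0 : {linear sp0 V -> sp0 E} := hom0 (ext_i E).
Definition inc1 : {linear sp1 V -> sp1 E} := hom1 (ext_i E).
Definition prj0 : {linear sp0 E -> sp0 A} := hom0 (ext_p E).
Definition prj1 : {linear sp1 E -> sp1 A} := hom1 (ext_p E).

Lemma inc0_inj : injective inc0. Proof. exact: ext_i0_inj. Qed.
Lemma inc1_inj : injective inc1. Proof. exact: ext_i1_inj. Qed.

Lemma prj0_eq0 e : prj0 e = 0 <-> exists u, inc0 u = e.
Proof. exact: ext_exact0. Qed.
Lemma prj1_eq0 e : prj1 e = 0 <-> exists w, inc1 w = e.
Proof. exact: ext_exact1. Qed.

Lemma prj0_inc u : prj0 (inc0 u) = 0. Proof. by apply/prj0_eq0; exists u. Qed.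
Lemma prj1_inc w : prj1 (inc1 w) = 0. Proof. by apply/prj1_eq0; exists w. Qed.

Lemma inc0_tw u : tw0 E (inc0 u) = inc0 (tw0 V u).
Proof. exact: esym (hom_tw0 (ext_i E) u). Qed.
Lemma inc1_tw w : tw1 E (inc1 w) = inc1 (tw1 V w).
Proof. exact: esym (hom_tw1 (ext_i E) w). Qed.
End Inclusion.

Section Splitting.
Variable E : extension A V.
Variables (s0 : {linear sp0 A -> sp0 E}) (s1 : {linear sp1 A -> sp1 E}).

Section Retraction.
Hypothesis sP : linear_section s0 s1.

Lemma prj0_section x : prj0 E (s0 x) = x.
Proof. by case: sP => s0P _; exact: s0P. Qed.
Lemma prj1_section y : prj1 E (s1 y) = y.
Proof. by case: sP => _ s1P; exact: s1P. Qed.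

(** The projection of E onto V along the section: it extracts from an identity
    of E its component in V. *)
Lemma section_retraction :
  exists (q0 : {linear sp0 E -> sp0 V}) (q1 : {linear sp1 E -> sp1 V}),
    [/\ forall e, inc0 E (q0 e) = e - s0 (prj0 E e),
        forall e, inc1 E (q1 e) = e - s1 (prj1 E e),
        (forall x, q0 (s0 x) = 0) /\ (forall u, q0 (inc0 E u) = u)
      & (forall y, q1 (s1 y) = 0) /\ (forall v, q1 (inc1 E v) = v)].
Proof.
have [|q0 q0E] := @linear_lift K (sp0 V) (sp0 E) (sp0 E) (inc0 E)
  (idfun \- (s0 \o prj0 E)) (@inc0_inj E).
  by move=> e; apply/prj0_eq0; rewrite /= linearB /= prj0_section subrr.
have [|q1 q1E] := @linear_lift K (sp1 V) (sp1 E) (sp1 E) (inc1 E)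
  (idfun \- (s1 \o prj1 E)) (@inc1_inj E).
  by move=> e; apply/prj1_eq0; rewrite /= linearB /= prj1_section subrr.
exists q0, q1; split=> //; split=> [x|u].
- by apply: (@inc0_inj E); rewrite q0E /= prj0_section subrr linear0.
- by apply: (@inc0_inj E); rewrite q0E /= prj0_inc linear0 subr0.
- by apply: (@inc1_inj E); rewrite q1E /= prj1_section subrr linear0.
- by apply: (@inc1_inj E); rewrite q1E /= prj1_inc linear0 subr0.
Qed.

Lemma split0_ex e : exists x u, e = s0 x + inc0 E u.
Proof.
have [q0 [_ [q0E _ _ _]]] := section_retraction.
by exists (prj0 E e), (q0 e); rewrite q0E addrC subrK.
Qed.

Lemma split1_ex e : exists y w, e = s1 y + inc1 E w.
Proof.
have [_ [q1 [_ q1E _ _]]] := section_retraction.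
by exists (prj1 E e), (q1 e); rewrite q1E addrC subrK.
Qed.

Lemma section_cochain : exists w : cochain2 A V, cochain_of_section s0 s1 w.
Proof.
have [q0 [q1 [q0E q1E _ _]]] := section_retraction.
have [v0 v0E] := bilinear_comp (mul00 E) s0 s0 q0.
have [v1 v1E] := bilinear_comp (mul01 E) s0 s1 q1.
have [v2 v2E] := bilinear_comp (bra11 E) s1 s1 q0.
exists (Cochain2 v0 v1 v2); split=> [x1 x2|x y|y1 y2] /=.
- rewrite v0E [LHS]q0E /prj0 hom_mul00.
  by rewrite [hom0 _ (s0 x1)]prj0_section [hom0 _ (s0 x2)]prj0_section.
- rewrite v1E [LHS]q1E /prj1 hom_mul01.
  by rewrite [hom0 _ (s0 x)]prj0_section [hom1 _ (s1 y)]prj1_section.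
- rewrite v2E [LHS]q0E /prj0 hom_bra11.
  by rewrite [hom1 _ (s1 y1)]prj1_section [hom1 _ (s1 y2)]prj1_section.
Qed.

Hypotheses (abE : abelian_extension E) (indE : induces E rho).

Lemma inc_mul00 u u' : mul00 E (inc0 E u) (inc0 E u') = 0.
Proof. by case: abE => [[h _ _] _]; apply: h; [exists u | exists u']. Qed.
Lemma inc_mul01 u w : mul01 E (inc0 E u) (inc1 E w) = 0.
Proof. by case: abE => [[_ h _] _]; apply: h; [exists u | exists w]. Qed.
Lemma inc_bra11 w w' : bra11 E (inc1 E w) (inc1 E w') = 0.
Proof. by case: abE => [[_ _ h] _]; apply: h; [exists w | exists w']. Qed.

(** The actions of A on V are given by rho for the section that witnesses
    [induces], hence for every section: two sections differ by elements of V,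
    which act trivially on V. *)
Lemma section_action :
  [/\ forall x u, mul00 E (s0 x) (inc0 E u) = inc0 E (r00 rho x u),
      forall x w, mul01 E (s0 x) (inc1 E w) = inc1 E (r01 rho x w),
      forall y u, mul01 E (inc0 E u) (s1 y) = inc1 E (r10 rho y u)
    & forall y w, bra11 E (s1 y) (inc1 E w) = inc0 E (r11 rho y w)].
Proof.
have [t0 [t1 [[t0P t1P] [rho00 rho01 rho10 rho11]]]] := indE.
have s0E x : exists u, s0 x = t0 x + inc0 E u.
  have /prj0_eq0[u uE] : prj0 E (s0 x - t0 x) = 0.
    by rewrite linearB prj0_section [prj0 E (t0 x)]t0P subrr.
  by exists u; rewrite uE addrC subrK.
have s1E y : exists w, s1 y = t1 y + inc1 E w.
  have /prj1_eq0[w wE] : prj1 E (s1 y - t1 y) = 0.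
    by rewrite linearB prj1_section [prj1 E (t1 y)]t1P subrr.
  by exists w; rewrite wE addrC subrK.
split=> [x u|x w|y u|y w].
- have [u' ->] := s0E x.
  by rewrite linearDl inc_mul00 addr0 [RHS]rho00.
- have [u' ->] := s0E x.
  by rewrite linearDl inc_mul01 addr0 [RHS]rho01.
- have [w' ->] := s1E y.
  by rewrite linearDr inc_mul01 addr0 [RHS]rho10.
- have [w' ->] := s1E y.
  by rewrite linearDl inc_bra11 addr0 [RHS]rho11.
Qed.

End Retraction.

Variable w : cochain2 A V.
Hypotheses (abE : abelian_extension E) (indE : induces E rho).
Hypotheses (sP : hom_section s0 s1) (wP : cochain_of_section s0 s1 w).

Let linP : linear_section s0 s1. Proof. by case: sP. Qed.

Lemma split_mul00 x u x' u' :
  mul00 E (s0 x + inc0 E u) (s0 x' + inc0 E u') =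
  s0 (mul00 A x x')
    + inc0 E (r00 rho x u' + r00 rho x' u + w0 w x x').
Proof.
have [a00 _ _ _] := section_action linP abE indE; case: wP => wE _ _.
rewrite linearDl !linearDr inc_mul00 // addr0 [mul00 E (inc0 E u) _]mul00C !a00.
rewrite !linearD /= [inc0 E (w0 w x x')]wE.
by rewrite [RHS]addrC addrA subrK; sum_perm.
Qed.

Lemma split_mul01 x u y v :
  mul01 E (s0 x + inc0 E u) (s1 y + inc1 E v) =
  s1 (mul01 A x y) + inc1 E (r01 rho x v + r10 rho y u + w1 w x y).
Proof.
have [_ a01 a10 _] := section_action linP abE indE; case: wP => _ wE _.
rewrite linearDl !linearDr inc_mul01 // addr0 a10 a01.
rewrite !linearD /= [inc1 E (w1 w x y)]wE.
by rewrite [RHS]addrC addrA subrK; sum_perm.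
Qed.

Lemma split_bra11 y v y' v' :
  bra11 E (s1 y + inc1 E v) (s1 y' + inc1 E v') =
  s0 (bra11 A y y')
    + inc0 E (r11 rho y v' - r11 rho y' v + w2 w y y').
Proof.
have [_ _ _ a11] := section_action linP abE indE; case: wP => _ _ wE.
rewrite linearDl !linearDr inc_bra11 // addr0 [bra11 E (inc1 E v) _]bra11N !a11.
rewrite !linearD linearN /= [inc0 E (w2 w y y')]wE.
by rewrite [RHS]addrC addrA subrK; sum_perm.
Qed.

Lemma split_tw0 x u : tw0 E (s0 x + inc0 E u) = s0 (tw0 A x) + inc0 E (tw0 V u).
Proof. by case: sP => _ h _; rewrite linearD inc0_tw h. Qed.
Lemma split_tw1 y v : tw1 E (s1 y + inc1 E v) = s1 (tw1 A y) + inc1 E (tw1 V v).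
Proof. by case: sP => _ _ h; rewrite linearD inc1_tw h. Qed.

Lemma section_mul00 x x' :
  mul00 E (s0 x) (s0 x') = s0 (mul00 A x x') + inc0 E (w0 w x x').
Proof. by case: wP => h _ _; rewrite [X in _ + X]h addrC subrK. Qed.
Lemma section_mul01 x y :
  mul01 E (s0 x) (s1 y) = s1 (mul01 A x y) + inc1 E (w1 w x y).
Proof. by case: wP => _ h _; rewrite [X in _ + X]h addrC subrK. Qed.
Lemma section_bra11 y y' :
  bra11 E (s1 y) (s1 y') = s0 (bra11 A y y') + inc0 E (w2 w y y').
Proof. by case: wP => _ _ h; rewrite [X in _ + X]h addrC subrK. Qed.

(** Each clause is the V-component of the identity of E with the same shape,
    evaluated on the image of the section; its A-component is the identity
    of A. *)
Lemma cocycle_of_section : multiplicative E -> cocycle2 rho w.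
Proof.
case=> m00 m01 m11; have [_ tws0 tws1] := sP.
have [a00 a01 a10 a11] := section_action linP abE indE.
have [q0 [q1 [_ _ [q0s q0i] [q1s q1i]]]] := section_retraction linP.
have qE := (q0s, q0i, q1s, q1i, add0r, addr0).
split; [split|split; split].
- move=> x1 x2; have := congr1 q0 (mul00C (s0 x1) (s0 x2)).
  by rewrite !section_mul00 !linearD !qE.
- move=> y1 y2; have := congr1 q0 (bra11N (s1 y1) (s1 y2)).
  by rewrite !section_bra11 linearN !(linearD q0) !qE.
- move=> x1 x2; have := congr1 q0 (m00 (s0 x1) (s0 x2)).
  by rewrite -!tws0 !section_mul00 split_tw0 !linearD !qE.
- move=> x1 y1; have := congr1 q1 (m01 (s0 x1) (s1 y1)).
  by rewrite -tws0 -tws1 !section_mul01 split_tw1 !linearD !qE.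
- move=> y1 y2; have := congr1 q0 (m11 (s1 y1) (s1 y2)).
  by rewrite -!tws1 !section_bra11 split_tw0 !linearD !qE.
- move=> x1 x2 x3; have := congr1 q0 (hla_ax1 (s0 x1) (s0 x2) (s0 x3)).
  rewrite -!tws0 !section_mul00 linearDr linearDl /=.
  rewrite [mul00 E (inc0 E _) _]mul00C !a00 !section_mul00 !linearD !qE => e.
  by rewrite addrC e addrC.
- move=> x1 x2 y1; have := congr1 q1 (hla_ax2 (s0 x1) (s0 x2) (s1 y1)).
  rewrite -tws0 -tws1 section_mul01 section_mul00 linearDr linearDl /=.
  rewrite a01 a10 !section_mul01 linearZ !(linearD q1) !qE /= scalerDr => e.
  by rewrite addrC e addrC.
- move=> x1 y1 y2; have := congr1 q0 (hla_ax3 (s0 x1) (s1 y1) (s1 y2)).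
  rewrite -tws0 -!tws1 !section_bra11 !section_mul01 !linearDr linearDl /=.
  rewrite [bra11 E (inc1 E _) _]bra11N !a11 a00 section_mul00 !section_bra11.
  rewrite !(linearD q0) (linearN q0) !qE => e.
  by rewrite addrC e; sum_perm.
- move=> y1 y2 y3; have := congr1 q1 (hla_ax4 (s1 y1) (s1 y2) (s1 y3)).
  rewrite -!tws1 !section_bra11 !linearDl /= !a10 !section_mul01.
  by rewrite !linearD linear0 !qE => <-; sum_perm.
Qed.

End Splitting.

(** * Equivalence of extensions and cohomology of cochains *)

Section Equivalence.
Variables (E F : extension A V) (w w' : cochain2 A V).
Variables (s0 : {linear sp0 A -> sp0 E}) (s1 : {linear sp1 A -> sp1 E}).
Variables (t0 : {linear sp0 A -> sp0 F}) (t1 : {linear sp1 A -> sp1 F}).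
Hypotheses (abE : abelian_extension E) (indE : induces E rho).
Hypotheses (abF : abelian_extension F) (indF : induces F rho).
Hypotheses (sP : hom_section s0 s1) (wP : cochain_of_section s0 s1 w).
Hypotheses (tP : hom_section t0 t1) (wP' : cochain_of_section t0 t1 w').

(** The coboundary comes from f(x) = phi(s(x)) - t(x), which lies in V. *)
Lemma equiv_cohomologous : extension_equiv E F -> cohomologous rho w w'.
Proof.
move=> [phi [phi_i0 phi_i1 phi_p0 phi_p1]].
have [linS ss0 ss1] := sP; have [linT tt0 tt1] := tP.
have [q0 [q1 [q0E q1E [q0t q0i] [q1t q1i]]]] := section_retraction linT.
have qE := (q0t, q0i, q1t, q1i, add0r, addr0).
pose f0 : {linear sp0 A -> sp0 V} := q0 \o hom0 phi \o s0.
pose f1 : {linear sp1 A -> sp1 V} := q1 \o hom1 phi \o s1.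
have phi0 x : hom0 phi (s0 x) = t0 x + inc0 F (f0 x).
  rewrite q0E [prj0 F _](etrans (phi_p0 _) (prj0_section linS x)).
  by rewrite addrC subrK.
have phi1 y : hom1 phi (s1 y) = t1 y + inc1 F (f1 y).
  rewrite q1E [prj1 F _](etrans (phi_p1 _) (prj1_section linS y)).
  by rewrite addrC subrK.
exists f0, f1; split; split.
- move=> x; have := congr1 q0 (phi0 (tw0 A x)).
  by rewrite ss0 hom_tw0 phi0 (split_tw0 tP) !linearD !qE.
- move=> y; have := congr1 q1 (phi1 (tw1 A y)).
  by rewrite ss1 hom_tw1 phi1 (split_tw1 tP) !linearD !qE.
- move=> x1 x2; have := congr1 q0 (hom_mul00 phi (s0 x1) (s0 x2)).
  rewrite !phi0 (split_mul00 abF indF tP wP') (section_mul00 wP).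
  rewrite linearD [hom0 phi (inc0 E _)]phi_i0 phi0 !linearD !qE => e.
  by apply/eqP; rewrite subr_eq addrAC -e addrAC subrr add0r.
- move=> x1 y1; have := congr1 q1 (hom_mul01 phi (s0 x1) (s1 y1)).
  rewrite phi0 !phi1 (split_mul01 abF indF tP wP') (section_mul01 wP).
  rewrite linearD [hom1 phi (inc1 E _)]phi_i1 phi1 !linearD !qE => e.
  by apply/eqP; rewrite subr_eq addrAC -e addrAC subrr add0r.
- move=> y1 y2; have := congr1 q0 (hom_bra11 phi (s1 y1) (s1 y2)).
  rewrite !phi1 (split_bra11 abF indF tP wP') (section_bra11 wP).
  rewrite linearD [hom0 phi (inc0 E _)]phi_i0 phi0 !linearD !qE => e.
  by apply/eqP; rewrite subr_eq addrAC -e addrAC subrr add0r.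
Qed.

(** The required homomorphism is s(x) + i(u) |-> t(x) + j(u + f(x)). *)
Lemma cohomologous_equiv : cohomologous rho w w' -> extension_equiv E F.
Proof.
move=> [f0 [f1 [[f0tw f1tw] [f00 f01 f11]]]].
have [linS ss0 ss1] := sP; have [linT tt0 tt1] := tP.
have [q0 [q1 [q0E q1E [q0s q0i] [q1s q1i]]]] := section_retraction linS.
have qE := (q0s, q0i, q1s, q1i, add0r, addr0).
pose phi0 : {linear sp0 E -> sp0 F} :=
  (t0 \o prj0 E) \+ (inc0 F \o (q0 \+ (f0 \o prj0 E))).
pose phi1 : {linear sp1 E -> sp1 F} :=
  (t1 \o prj1 E) \+ (inc1 F \o (q1 \+ (f1 \o prj1 E))).
have phi0E x u : phi0 (s0 x + inc0 E u) = t0 x + inc0 F (u + f0 x).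
  rewrite /phi0 /= !linearD /= (prj0_section linS) prj0_inc.
  by rewrite !linear0 !qE linear0 add0r.
have phi1E y v : phi1 (s1 y + inc1 E v) = t1 y + inc1 F (v + f1 y).
  rewrite /phi1 /= !linearD /= (prj1_section linS) prj1_inc.
  by rewrite !linear0 !qE linear0 add0r.
have h00 e e' : phi0 (mul00 E e e') = mul00 F (phi0 e) (phi0 e').
  have [x [u ->]] := split0_ex linS e; have [x' [u' ->]] := split0_ex linS e'.
  rewrite (split_mul00 abE indE sP wP) !phi0E (split_mul00 abF indF tP wP').
  congr (_ + inc0 F _); rewrite !linearD /=.
  have /eqP := f00 x x'; rewrite subr_eq => /eqP->.
  by rewrite -addrA (addrAC _ (- _)) subrK; sum_perm.
have h01 e e' : phi1 (mul01 E e e') = mul01 F (phi0 e) (phi1 e').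
  have [x [u ->]] := split0_ex linS e; have [y [v ->]] := split1_ex linS e'.
  rewrite (split_mul01 abE indE sP wP) phi0E !phi1E.
  rewrite (split_mul01 abF indF tP wP').
  congr (_ + inc1 F _); rewrite !linearD /=.
  have /eqP := f01 x y; rewrite subr_eq => /eqP->.
  by rewrite -addrA (addrAC _ (- _)) subrK; sum_perm.
have h11 e e' : phi0 (bra11 E e e') = bra11 F (phi1 e) (phi1 e').
  have [y [v ->]] := split1_ex linS e; have [y' [v' ->]] := split1_ex linS e'.
  rewrite (split_bra11 abE indE sP wP) phi0E !phi1E.
  rewrite (split_bra11 abF indF tP wP').
  congr (_ + inc0 F _); rewrite !linearD /=.
  have /eqP := f11 y y'; rewrite subr_eq => /eqP->.
  by rewrite -addrA (addrAC _ (- f0 _)) subrK; sum_perm.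
have htw0 e : phi0 (tw0 E e) = tw0 F (phi0 e).
  have [x [u ->]] := split0_ex linS e.
  by rewrite (split_tw0 sP) !phi0E (split_tw0 tP) (linearD (tw0 V)) f0tw.
have htw1 e : phi1 (tw1 E e) = tw1 F (phi1 e).
  have [y [v ->]] := split1_ex linS e.
  by rewrite (split_tw1 sP) !phi1E (split_tw1 tP) (linearD (tw1 V)) f1tw.
have phi_p0 e : prj0 F (phi0 e) = prj0 E e.
  have [x [u ->]] := split0_ex linS e.
  rewrite phi0E !linearD /= !prj0_inc !addr0.
  by rewrite (prj0_section linS) (prj0_section linT).
have phi_p1 e : prj1 F (phi1 e) = prj1 E e.
  have [y [v ->]] := split1_ex linS e.
  rewrite phi1E !linearD /= !prj1_inc !addr0.
  by rewrite (prj1_section linS) (prj1_section linT).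
exists (HlaHom h00 h01 h11 htw0 htw1); split=> [u|v|e|e].
- have := phi0E 0 u.
  by rewrite (linear0 s0) (linear0 t0) (linear0 f0) addr0 !add0r.
- have := phi1E 0 v.
  by rewrite (linear0 s1) (linear0 t1) (linear0 f1) addr0 !add0r.
- exact: phi_p0.
- exact: phi_p1.
Qed.
End Equivalence.

(** * The extension defined by a 2-cocycle *)

Section CocycleExtension.
Hypotheses (multA : multiplicative A) (mult_rho : multiplicative_rep rho).
Variable w : cochain2 A V.
Hypothesis wP : cocycle2 rho w.

Definition ext_space : hom_space K :=
  @HomSpace K (sp0 A * sp0 V)%type (sp1 A * sp1 V)%type
    (pair_map (tw0 A) (tw0 V)) (pair_map (tw1 A) (tw1 V)).

Local Notation E00 := (ext_prod 1 (mul00 A) (w0 w) (r00 rho) (r00 rho)).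
Local Notation E01 := (ext_prod 1 (mul01 A) (w1 w) (r01 rho) (r10 rho)).
Local Notation E11 := (ext_prod (-1) (bra11 A) (w2 w) (r11 rho) (r11 rho)).

Fact ext_mul00C e e' : E00 e e' = E00 e' e.
Proof.
case: wP e e' => [[w0C _] _] [x1 u1] [x2 u2].
congr (_, _); rewrite /= ?scale1r; first exact: mul00C.
by rewrite w0C; sum_perm.
Qed.

Fact ext_bra11N e e' : E11 e e' = - E11 e' e.
Proof.
case: wP e e' => [[_ w2N] _] [y1 v1] [y2 v2].
congr (_, _); rewrite /= ?scaleN1r; first exact: bra11N.
by rewrite w2N !opprD opprK; sum_perm.
Qed.

(* In the identities below the summands that involve an element of V cancel by
   the axioms of rho, and what is left is the cocycle identity of w.  In
   the first three, that identity is used by adding one of its sides to both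
   sides of the goal. *)
Fact ext_ax1 e1 e2 e3 :
  E00 (tw0 ext_space e1) (E00 e2 e3) = E00 (E00 e1 e2) (tw0 ext_space e3).
Proof.
case: wP e1 e2 e3 => [_ [_ [c _ _ _]]] [x1 u1] [x2 u2] [x3 u3].
congr (_, _); rewrite /= ?scale1r; first exact: hla_ax1.
rewrite !linearD /= !rep_ax1 (mul00C x3 x1) (mul00C x3 x2).
apply: (addIr (r00 rho (tw0 A x1) (w0 w x2 x3)
  + w0 w (tw0 A x1) (mul00 A x2 x3))).
by rewrite {1}c; sum_perm.
Qed.

Fact ext_ax2 e1 e2 e3 :
  E01 (tw0 ext_space e1) (E01 e2 e3)
    = (2%:R : K)^-1 *: E01 (E00 e1 e2) (tw1 ext_space e3).
Proof.
case: wP e1 e2 e3 => [_ [_ [_ c _ _]]] [x1 u1] [x2 u2] [y3 v3].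
congr (_, _); rewrite /= ?scale1r; first exact: hla_ax2.
rewrite !linearD /= rep_ax2 rep_ax3 rep_ax4.
apply: (addIr (r01 rho (tw0 A x1) (w1 w x2 y3)
  + w1 w (tw0 A x1) (mul01 A x2 y3))).
by rewrite {1}c; sum_perm.
Qed.

Fact ext_ax3 e1 e2 e3 :
  E00 (tw0 ext_space e1) (E11 e2 e3)
    = E11 (E01 e1 e2) (tw1 ext_space e3) + E11 (tw1 ext_space e2) (E01 e1 e3).
Proof.
case: wP e1 e2 e3 => [_ [_ [_ _ c _]]] [x1 u1] [y2 v2] [y3 v3].
congr (_, _); rewrite /= ?scale1r ?scaleN1r; first exact: hla_ax3.
rewrite !linearD !linearN /= !rep_ax5 rep_ax6.
apply: (addIr (r00 rho (tw0 A x1) (w2 w y2 y3)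
  + w0 w (tw0 A x1) (bra11 A y2 y3))).
by rewrite {1}c opprD; sum_perm.
Qed.

Fact ext_ax4 e1 e2 e3 :
  E01 (E11 e2 e3) (tw1 ext_space e1) + E01 (E11 e3 e1) (tw1 ext_space e2)
    + E01 (E11 e1 e2) (tw1 ext_space e3) = 0.
Proof.
case: wP e1 e2 e3 => [_ [_ [_ _ _ c]]] [y1 v1] [y2 v2] [y3 v3].
congr (_, _); rewrite /= ?scale1r ?scaleN1r; first exact: hla_ax4.
rewrite !linearD !linearN /= !rep_ax7 -[RHS](c y1 y2 y3).
by sum_cancel; sum_perm.
Qed.

Definition ext_hla : hom_Lie_antialgebra K :=
  @HomLieAntialgebra K ext_space E00 E01 E11
    ext_mul00C ext_bra11N ext_ax1 ext_ax2 ext_ax3 ext_ax4.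

(** Multiplicativity on A + V splits into that of A, that of rho, and the
    compatibility of w with the twisting maps. *)
Lemma ext_hla_multiplicative : multiplicative ext_hla.
Proof.
case: multA mult_rho wP => [m00 m01 m11] [n00 n01 n10 n11] [_ [[c0 c1 c2] _]].
split=> [[x1 u1] [x2 u2]|[x1 u1] [y2 v2]|[y1 v1] [y2 v2]];
  congr (_, _); rewrite /= ?scale1r ?scaleN1r //.
- by rewrite !linearD /= !n00 c0.
- by rewrite !linearD /= n01 n10 c1.
- by rewrite !linearD linearN /= !n11 c2.
Qed.

Definition ext_inc : hla_hom (abelian_hla V) ext_hla.
Proof.
refine (@HlaHom K (abelian_hla V) ext_hla
  (@inj_snd K (sp0 A) (sp0 V)) (@inj_snd K (sp1 A) (sp1 V)) _ _ _ _ _).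
- by move=> u u'; congr (_, _); rewrite /= !(linear0, linear0l, scaler0, addr0).
- by move=> u v; congr (_, _); rewrite /= !(linear0, linear0l, scaler0, addr0).
- by move=> v v'; congr (_, _); rewrite /= !(linear0, linear0l, scaler0, addr0).
- by move=> u; congr (_, _); rewrite /= linear0.
- by move=> v; congr (_, _); rewrite /= linear0.
Defined.

Definition ext_prj : hla_hom ext_hla A :=
  @HlaHom K ext_hla A (fst : {linear (sp0 A * sp0 V)%type -> sp0 A})
    (fst : {linear (sp1 A * sp1 V)%type -> sp1 A})
    (fun _ _ => erefl) (fun _ _ => erefl) (fun _ _ => erefl)
    (fun _ => erefl) (fun _ => erefl).

Definition cocycle_ext : extension A V.
Proof.
refine (@Extension K A V ext_hla ext_inc ext_prj _ _ _ _ _ _).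
- by move=> u u' [].
- by move=> v v' [].
- by move=> [x u]; split=> [/= ->|[u' [<- _]] //]; exists u.
- by move=> [y v]; split=> [/= ->|[v' [<- _]] //]; exists v.
- by move=> x; exists (x, 0).
- by move=> y; exists (y, 0).
Defined.

Let sec0 : {linear sp0 A -> sp0 cocycle_ext} := @inj_fst K (sp0 A) (sp0 V).
Let sec1 : {linear sp1 A -> sp1 cocycle_ext} := @inj_fst K (sp1 A) (sp1 V).

Lemma cocycle_ext_section : hom_section sec0 sec1.
Proof. by split=> // [x|y]; congr (_, _); rewrite /= linear0. Qed.

Lemma cocycle_ext_cochain : cochain_of_section sec0 sec1 w.
Proof.
split=> [x1 x2|x y|y1 y2]; congr (_, _);
  by rewrite /= ?subrr // !(linear0, scaler0, addr0, add0r, subr0).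
Qed.

Lemma cocycle_ext_abelian : abelian_extensions rho cocycle_ext.
Proof.
split.
- exact: ext_hla_multiplicative.
- split; split.
  + move=> _ _ [u <-] [u' <-]; congr (_, _);
      by rewrite /= !(linear0, linear0l, scaler0, addr0).
  + move=> _ _ [u <-] [v <-]; congr (_, _);
      by rewrite /= !(linear0, linear0l, scaler0, addr0).
  + move=> _ _ [v <-] [v' <-]; congr (_, _);
      by rewrite /= !(linear0, linear0l, scaler0, addr0).
  + move=> e _ [u <-]; exists (E00 e (0, u)).2.
    by congr (_, _); rewrite /= linear0.
  + move=> e _ [v <-]; exists (E01 e (0, v)).2.
    by congr (_, _); rewrite /= linear0.
  + move=> e _ [u <-]; exists (E01 (0, u) e).2.
    by congr (_, _); rewrite /= linear0l.
  + move=> e _ [v <-]; exists (E11 e (0, v)).2.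
    by congr (_, _); rewrite /= linear0.
- exists sec0, sec1; split; first by case: cocycle_ext_section.
  split=> [x u|x v|y u|y v]; congr (_, _);
    by rewrite /= !(linear0, linear0l, scaler0, addr0, add0r, scale1r).
- by exists sec0, sec1; exact: cocycle_ext_section.
Qed.
End CocycleExtension.
End AbelianExtensions.

(** * Classification of abelian extensions *)

Unset Implicit Arguments.

Theorem theorem1 (K : closedFieldType) (charK0 : [pchar K] =i pred0)
    (A : hom_Lie_antialgebra K) (multA : multiplicative A)
    (V : hom_space K) (rho : representation A V)
    (mult_rho : multiplicative_rep rho) :
  exists Phi : extension_classes rho -> H2 rho,
    bijective Phi /\
    (forall (c : extension_classes rho) (E : extension A V)
            (s0 : {linear sp0 A -> sp0 E}) (s1 : {linear sp1 A -> sp1 E})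
            (w : cochain2 A V),
       sval c E -> hom_section s0 s1 -> cochain_of_section s0 s1 w ->
       sval (Phi c) w).
Proof.
pose C (E : extension A V) w :=
  exists (s0 : {linear sp0 A -> sp0 E}) (s1 : {linear sp1 A -> sp1 E}),
    hom_section s0 s1 /\ cochain_of_section s0 s1 w.
have [|||| Phi [Phi_bij PhiC]] := @quotient_correspondence _ _
    (abelian_extensions rho) (cocycle2 rho) (@extension_equiv K A V)
    (cohomologous rho) C.
- move=> E [_ _ _ [s0 [s1 sP]]]; have [linS _ _] := sP.
  by have [w wP] := section_cochain linS; exists w, s0, s1.
- move=> E w [mE abE indE _] [s0 [s1 [sP wP]]].
  exact: cocycle_of_section abE indE sP wP mE.
- move=> w wP; exists (cocycle_ext wP); first exact: cocycle_ext_abelian.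
  by eexists; eexists; split;
    [exact: cocycle_ext_section | exact: cocycle_ext_cochain].
- move=> E F w w' [_ abE indE _] [_ abF indF _].
  move=> [s0 [s1 [sP wP]]] [t0 [t1 [tP wP']]]; split.
    exact: equiv_cohomologous abF indF sP wP tP wP'.
  exact: cohomologous_equiv abE indE abF indF sP wP tP wP'.
exists Phi; split=> // c E s0 s1 w cE sP wP.
by apply: PhiC cE _; exists s0, s1.
Qed.
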